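(* There exist no totally geodesic proper QGCR-lightlike submanifolds $(M,g,S(TM),S(TM^\perp))$, with totally geodesic screen distributions, of an indefinite nearly Sasakian manifold $(\overline{M},\overline{\phi},\eta,\xi,\overline{g})$ with the structure vector field $\xi$ transversal to $M$ (that is, $\xi\in\Gamma(\mathrm{tr}(TM))$ along $M$).
   Context: Notation: $\Gamma(\Xi)$ is the set of smooth sections of a vector bundle $\Xi$. Indefinite nearly Sasakian manifold: a $(2n+1)$-dimensional manifold $\overline{M}$ with a $(1,1)$-tensor $\overline{\phi}$, a vector field $\xi$, a 1-form $\eta$ and a semi-Riemannian metric $\overline{g}$ with Levi-Civita connection $\overline{\nabla}$ such that $\overline{\phi}^2=-I+\eta\otimes\xi$, $\eta(\xi)=1$, $\eta\circ\overline{\phi}=0$, $\overline{\phi}\xi=0$, $\overline{g}(\overline{\phi}X,\overline{\phi}Y)=\overline{g}(X,Y)-\eta(X)\eta(Y)$ (hence $\eta=\overline{g}(\xi,\cdot)$), and $(\overline{\nabla}_X\overline{\phi})Y+(\overline{\nabla}_Y\overline{\phi})X=2\overline{g}(X,Y)\xi-\eta(Y)X-\eta(X)Y$ for all $X,Y$. Lightlike submanifold: a submanifold $M$ of $\overline{M}$, with $g$ the induced (degenerate) metric, such that $\mathrm{Rad}\,TM=TM\cap TM^\perp$ is a smooth distribution of rank $r>0$. A screen distribution $S(TM)$ is a semi-Riemannian (non-degenerate) complement of $\mathrm{Rad}\,TM$ in $TM$; $S(TM^\perp)$ is a semi-Riemannian complement of $\mathrm{Rad}\,TM$ in $TM^\perp$.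 The lightlike transversal bundle $l\mathrm{tr}(TM)$ is locally spanned by null sections $N_i$ of the orthogonal complement of $S(TM^\perp)$ in $S(TM)^\perp$ with $\overline{g}(E_i,N_j)=\delta_{ij}$, $\overline g(N_i,N_j)=0$ for a local basis $\{E_i\}$ of $\mathrm{Rad}\,TM$. Put $\mathrm{tr}(TM)=l\mathrm{tr}(TM)\perp S(TM^\perp)$, so $T\overline{M}|_M=TM\oplus\mathrm{tr}(TM)$. The Gauss formula is $\overline{\nabla}_XY=\nabla_XY+h(X,Y)$ for $X,Y\in\Gamma(TM)$, with $\nabla_XY\in\Gamma(TM)$ and $h(X,Y)\in\Gamma(\mathrm{tr}(TM))$. With $P$ the projection of $TM$ onto $S(TM)$ along $\mathrm{Rad}\,TM$, write $\nabla_XPY=\nabla^*_XPY+\sum_{i=1}^r h_i^*(X,PY)E_i$ with $\nabla^*_XPY\in\Gamma(S(TM))$. $M$ is totally geodesic if $h=0$; the screen distribution is totally geodesic if all $h_i^*=0$. QGCR-lightlike submanifold: a lightlike submanifold $(M,g,S(TM),S(TM^\perp))$ of $\overline{M}$ is Quasi Generalized Cauchy-Riemann (QGCR) if (i) there are distributions $D_1,D_2$ of $\mathrm{Rad}\,TM$ with $\mathrm{Rad}\,TM=D_1\oplus D_2$, $\overline{\phi}D_1=D_1$, $\overline{\phi}D_2\subset S(TM)$; (ii) there are subbundles $D_0,\overline{D}$ of $S(TM)$ with $S(TM)=\{\overline{\phi}D_2\oplus\overline{D}\}\perp D_0$, $\overline{\phi}D_0\subseteq D_0$, $\overline{D}=\overline{\phi}\mathcal{S}\oplus\overline{\phi}\mathcal{L}$,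 where $D_0$ is non-degenerate and $\mathcal{L}$, $\mathcal{S}$ are vector subbundles of $l\mathrm{tr}(TM)$ and $S(TM^\perp)$ respectively. In (ii) the symbol $\oplus$ denotes a (not necessarily orthogonal) sum of subbundles, and the summands $\overline{\phi}D_2$ and $\overline{\phi}\mathcal{L}$ are allowed to intersect. $M$ is proper if $D_0,D_1,D_2,\mathcal{S}$ are all nonzero. *)

(* Defs.v *)
From HB Require Import structures.
From mathcomp Require Import all_boot all_order all_algebra.
From mathcomp Require Import all_classical all_reals all_analysis.

Set Implicit Arguments.
Unset Strict Implicit.
Unset Printing Implicit Defensive.

Import Order.TTheory GRing.Theory Num.Theory.
Import numFieldNormedType.Exports.

Local Open Scope classical_set_scope.
Local Open Scope ring_scope.

Fixpoint ndifferentiable (R : realType) (m : nat) (V : normedModType R)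
    (k : nat) (U : set 'rV[R]_m) (f : 'rV[R]_m -> V) : Prop :=
  if k is k'.+1 then
    (forall x, U x -> differentiable f x) /\
    (forall v : 'rV[R]_m, ndifferentiable k' U (fun x => 'D_v f x : V))
  else True.

(* C^oo on the open set U: all iterated directional derivatives are Frechet
   differentiable on U. *)
Definition smooth_on (R : realType) (m : nat) (V : normedModType R)
    (U : set 'rV[R]_m) (f : 'rV[R]_m -> V) : Prop :=
  forall k, ndifferentiable k U f.

(* cmap and cinv are total functions; they are meaningful only on cdom and on
   cmap @` cdom, where they are inverse homeomorphisms. *)
Record chart (R : realType) (T : topologicalType) (m : nat) := Chart {
  cdom : set T;
  cmap : T -> 'rV[R]_m;
  cinv : 'rV[R]_m -> T;
  cdom_open : open cdom;
  cimage_open : open (cmap @` cdom);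
  cmapK : forall p, cdom p -> cinv (cmap p) = p;
  cmap_continuous : forall p, cdom p -> {for p, continuous cmap};
  cinv_continuous : forall x, (cmap @` cdom) x -> {for x, continuous cinv}
}.

Record manifold (R : realType) (m : nat) := Manifold {
  mpoint :> topologicalType;
  atlas : set (chart R mpoint m);
  chart_at : mpoint -> chart R mpoint m;
  manifold_hausdorff : hausdorff_space mpoint;
  manifold_second_countable : @second_countable mpoint;
  chart_at_atlas : forall p, atlas (chart_at p);
  chart_at_dom : forall p, cdom (chart_at p) p;
  atlas_compatible : forall c d, atlas c -> atlas d ->
    smooth_on (cmap c @` (cdom c `&` cdom d)) (cmap d \o cinv c)
}.

(* The tangent space at p is identified with 'rV[R]_m through the chart
   chart_at p.  A vector field is thus a function T -> 'rV[R]_m, an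
   endomorphism field a function T -> 'M[R]_m (acting on row vectors from the
   right), and [tcoord c p] is the change of coordinates on the tangent space
   at p from chart_at p to an arbitrary chart c around p. *)
Definition tcoord (R : realType) (m : nat) (T : manifold R m)
    (c : chart R T m) (p : T) : 'M[R]_m :=
  'J (cmap c \o cinv (chart_at p)) (cmap (chart_at p) p).

Definition tangent_map (R : realType) (m n : nat) (M : manifold R m)
    (N : manifold R n) (f : M -> N) (p : M) : 'M[R]_(m, n) :=
  'J (cmap (chart_at (f p)) \o f \o cinv (chart_at p)) (cmap (chart_at p) p).

(* v(f), for a tangent vector v at p *)
Definition vderive (R : realType) (m : nat) (M : manifold R m) (p : M)
    (v : 'rV[R]_m) (f : M -> R) : R :=
  'D_v (f \o cinv (chart_at p)) (cmap (chart_at p) p).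

Definition smooth_fun (R : realType) (m : nat) (M : manifold R m) (W : set M)
    (f : M -> R) : Prop :=
  forall c, atlas c -> smooth_on (cmap c @` (W `&` cdom c)) (f \o cinv c).

Definition smooth_map (R : realType) (m n : nat) (M : manifold R m)
    (N : manifold R n) (f : M -> N) : Prop :=
  continuous f /\
  forall c d, atlas c -> atlas d ->
    smooth_on (cmap c @` (cdom c `&` f @^-1` cdom d)) (cmap d \o f \o cinv c).

(* V is a smooth section over W of the pull-back by f of the tangent bundle
   of N, that is, a smooth vector field along f *)
Definition smooth_along (R : realType) (m n : nat) (M : manifold R m)
    (N : manifold R n) (f : M -> N) (W : set M) (V : M -> 'rV[R]_n) : Prop :=
  forall c d, atlas c -> atlas d ->
    smooth_on (cmap c @` (W `&` cdom c `&` f @^-1` cdom d))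
      (fun x => V (cinv c x) *m tcoord d (f (cinv c x))).

Definition smooth_field (R : realType) (m : nat) (M : manifold R m)
    (W : set M) (X : M -> 'rV[R]_m) : Prop := smooth_along (@id M) W X.

Definition bil (R : realType) (n : nat) (G : 'M[R]_n) (v w : 'rV[R]_n) : R :=
  (v *m G *m w^T) 0 0.

(* Subspaces are represented by the row spaces of matrices. *)
Definition gorth (R : realType) (m n : nat) (G : 'M[R]_n) (U : 'M[R]_(m, n)) :
    'M[R]_n := kermx (G *m U^T).

Definition nondegenerate (R : realType) (n : nat) (G U : 'M[R]_n) : Prop :=
  (U :&: gorth G U)%MS = 0.

Definition negative_on (R : realType) (n : nat) (G U : 'M[R]_n) : Prop :=
  forall v : 'rV[R]_n, (v <= U)%MS -> v != 0 -> bil G v v < 0.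

Definition has_index (R : realType) (n : nat) (G : 'M[R]_n) (q : nat) : Prop :=
  (exists2 U : 'M[R]_n, \rank U = q & negative_on G U) /\
  (forall U : 'M[R]_n, negative_on G U -> (\rank U <= q)%N).

Record semi_riemannian (R : realType) (n : nat) (N : manifold R n)
    (g : N -> 'M[R]_n) : Prop := SemiRiemannian {
  metric_sym : forall p, (g p)^T = g p;
  metric_nondegenerate : forall p, g p \in unitmx;
  metric_index : exists q, forall p, has_index (g p) q;
  metric_smooth : forall (W : set N) X Y, open W ->
    smooth_field W X -> smooth_field W Y ->
    smooth_fun W (fun p => bil (g p) (X p) (Y p))
}.

(* [nabla p v Y] is the covariant derivative at p of the vector field Y in the
   direction v.  It acts on vector fields defined over open sets: only the
   values on fields smooth near p are meaningful, and they depend only on the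
   germ of the field. *)
Record affine_connection (R : realType) (n : nat) (N : manifold R n)
    (nabla : N -> 'rV[R]_n -> (N -> 'rV[R]_n) -> 'rV[R]_n) : Prop :=
  AffineConnection {
  nabla_smooth : forall (W : set N) X Y, open W ->
    smooth_field W X -> smooth_field W Y ->
    smooth_field W (fun p => nabla p (X p) Y);
  nabla_local : forall (W : set N) Y Z p v, open W -> W p ->
    smooth_field W Y -> (forall q, W q -> Y q = Z q) ->
    nabla p v Y = nabla p v Z;
  nabla_linear : forall (W : set N) Y p (a : R) u v, open W -> W p ->
    smooth_field W Y ->
    nabla p (a *: u + v) Y = a *: nabla p u Y + nabla p v Y;
  nabla_additive : forall (W : set N) Y Z p v, open W -> W p ->
    smooth_field W Y -> smooth_field W Z ->
    nabla p v (fun q => Y q + Z q) = nabla p v Y + nabla p v Z;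
  nabla_leibniz : forall (W : set N) (f : N -> R) Y p v, open W -> W p ->
    smooth_fun W f -> smooth_field W Y ->
    nabla p v (fun q => f q *: Y q) =
      vderive p v f *: Y p + f p *: nabla p v Y
}.

(* Torsion-freeness says that nabla_X Y - nabla_Y X is the Lie bracket [X, Y],
   the vector field acting on functions by f |-> X(Y f) - Y(X f). *)
Record levi_civita (R : realType) (n : nat) (N : manifold R n)
    (g : N -> 'M[R]_n)
    (nabla : N -> 'rV[R]_n -> (N -> 'rV[R]_n) -> 'rV[R]_n) : Prop :=
  LeviCivita {
  lc_connection : affine_connection nabla;
  lc_torsion_free : forall (W : set N) X Y f p, open W -> W p ->
    smooth_field W X -> smooth_field W Y -> smooth_fun W f ->
    vderive p (nabla p (X p) Y - nabla p (Y p) X) f =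
      vderive p (X p) (fun q => vderive q (Y q) f) -
      vderive p (Y p) (fun q => vderive q (X q) f);
  lc_metric : forall (W : set N) Y Z p v, open W -> W p ->
    smooth_field W Y -> smooth_field W Z ->
    vderive p v (fun q => bil (g q) (Y q) (Z q)) =
      bil (g p) (nabla p v Y) (Z p) + bil (g p) (Y p) (nabla p v Z)
}.

Definition eta_of (R : realType) (n : nat) (N : manifold R n)
    (eta : N -> 'cV[R]_n) (p : N) (v : 'rV[R]_n) : R := (v *m eta p) 0 0.

(* (nabla_X phi) Y = nabla_X (phi Y) - phi (nabla_X Y) *)
Definition nabla_endo (R : realType) (n : nat) (N : manifold R n)
    (nabla : N -> 'rV[R]_n -> (N -> 'rV[R]_n) -> 'rV[R]_n)
    (phi : N -> 'M[R]_n) (X Y : N -> 'rV[R]_n) (p : N) : 'rV[R]_n :=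
  nabla p (X p) (fun q => Y q *m phi q) - nabla p (X p) Y *m phi p.

Record nearly_sasakian (R : realType) (n : nat) (N : manifold R (2 * n).+1)
    (phi : N -> 'M[R]_((2 * n).+1)) (xi : N -> 'rV[R]_((2 * n).+1))
    (eta : N -> 'cV[R]_((2 * n).+1)) (g : N -> 'M[R]_((2 * n).+1))
    (nabla : N -> 'rV[R]_((2 * n).+1) -> (N -> 'rV[R]_((2 * n).+1)) ->
             'rV[R]_((2 * n).+1)) : Prop := NearlySasakian {
  ns_metric : semi_riemannian g;
  ns_levi_civita : levi_civita g nabla;
  ns_phi_smooth : forall (W : set N) X, open W -> smooth_field W X ->
    smooth_field W (fun p => X p *m phi p);
  ns_xi_smooth : smooth_field [set: N] xi;
  ns_eta_smooth : forall (W : set N) X, open W -> smooth_field W X ->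
    smooth_fun W (fun p => eta_of eta p (X p));
  ns_phi_sq : forall p (v : 'rV[R]_((2 * n).+1)),
    v *m phi p *m phi p = - v + eta_of eta p v *: xi p;
  ns_eta_xi : forall p, eta_of eta p (xi p) = 1;
  ns_eta_phi : forall p v, eta_of eta p (v *m phi p) = 0;
  ns_phi_xi : forall p, xi p *m phi p = 0;
  ns_compat : forall p v w,
    bil (g p) (v *m phi p) (w *m phi p) =
      bil (g p) v w - eta_of eta p v * eta_of eta p w;
  ns_nearly : forall (W : set N) X Y p, open W -> W p ->
    smooth_field W X -> smooth_field W Y ->
    nabla_endo nabla phi X Y p + nabla_endo nabla phi Y X p =
      (2 * bil (g p) (X p) (Y p)) *: xi p
      - eta_of eta p (Y p) *: X p - eta_of eta p (X p) *: Y p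
}.

Definition immersed_submanifold (R : realType) (m n : nat) (M : manifold R m)
    (N : manifold R n) (i : M -> N) : Prop :=
  [/\ smooth_map i, injective i & forall p, row_free (tangent_map i p)].

(* TM as a subbundle of the restriction of TN to M: every bundle over M below
   is a family of subspaces of the tangent spaces of N at the points i p. *)
Definition TM (R : realType) (m n : nat) (M : manifold R m)
    (N : manifold R n) (i : M -> N) (p : M) : 'M[R]_n :=
  <<tangent_map i p>>%MS.

Definition frame_mx (R : realType) (n : nat) (T : Type) (r : nat)
    (E : 'I_r -> T -> 'rV[R]_n) (p : T) : 'M[R]_(r, n) := \matrix_(a < r) E a p.

Definition local_frame (R : realType) (m n : nat) (M : manifold R m)
    (N : manifold R n) (i : M -> N) (r : nat) (W : set M) (D : M -> 'M[R]_n)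
    (E : 'I_r -> M -> 'rV[R]_n) : Prop :=
  [/\ open W, forall a, smooth_along i W (E a) &
      forall p, W p -> row_free (frame_mx E p) /\ (frame_mx E p == D p)%MS].

Definition subbundle_rank (R : realType) (m n : nat) (M : manifold R m)
    (N : manifold R n) (i : M -> N) (r : nat) (D : M -> 'M[R]_n) : Prop :=
  forall p, exists (W : set M) (E : 'I_r -> M -> 'rV[R]_n),
    W p /\ local_frame i W D E.

Definition subbundle (R : realType) (m n : nat) (M : manifold R m)
    (N : manifold R n) (i : M -> N) (D : M -> 'M[R]_n) : Prop :=
  exists r, subbundle_rank i r D.

Definition section_of (R : realType) (m n : nat) (M : manifold R m)
    (N : manifold R n) (i : M -> N) (W : set M) (D : M -> 'M[R]_n)
    (X : M -> 'rV[R]_n) : Prop :=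
  smooth_along i W X /\ forall p, W p -> (X p <= D p)%MS.

Definition coord_field (R : realType) (n : nat) (N : manifold R n)
    (c : chart R N n) (a : 'I_n) (q : N) : 'rV[R]_n :=
  delta_mx 0 a *m 'J (cmap (chart_at q) \o cinv c) (cmap c q).

(* The covariant derivative of a vector field Y along i in the direction of
   X in TM, i.e. the connection induced by nabla on the restriction of TN to
   M.  Near p, Y = \sum_a Y^a (d_a \o i) in the coordinate frame d_a of the
   chart c of N chosen at i p, and the value at p is
     \sum_a (X(Y^a) d_a + Y^a nabla_X d_a),   with d_a (i p) = delta_mx 0 a.
   It is the common value at i p of nabla_X~ Y~ for all local extensions X~, Y~
   of X, Y to N. *)
Definition cov (R : realType) (m n : nat) (M : manifold R m)
    (N : manifold R n) (i : M -> N)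
    (nabla : N -> 'rV[R]_n -> (N -> 'rV[R]_n) -> 'rV[R]_n)
    (X Y : M -> 'rV[R]_n) (p : M) : 'rV[R]_n :=
  let c := chart_at (i p) in
  \sum_(a < n)
    (vderive p (X p *m pinvmx (tangent_map i p))
       (fun q => (Y q *m tcoord c (i q)) 0 a) *: delta_mx 0 a
     + (Y p) 0 a *: nabla (i p) (X p) (coord_field c a)).

Definition Rad (R : realType) (m n : nat) (M : manifold R m)
    (N : manifold R n) (i : M -> N) (g : N -> 'M[R]_n) (p : M) : 'M[R]_n :=
  (TM i p :&: gorth (g (i p)) (TM i p))%MS.

(* S is the screen distribution S(TM) and St is S(TM^perp). *)
Record lightlike_submanifold (R : realType) (m n : nat) (M : manifold R m)
    (N : manifold R n) (i : M -> N) (g : N -> 'M[R]_n) (r : nat)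
    (S St : M -> 'M[R]_n) : Prop := LightlikeSubmanifold {
  ll_submanifold : immersed_submanifold i;
  ll_rank : (0 < r)%N;
  ll_rad : subbundle_rank i r (Rad i g);
  ll_screen : subbundle i S;
  ll_screen_nondegenerate : forall p, nondegenerate (g (i p)) (S p);
  ll_screen_sum : forall p, (S p + Rad i g p == TM i p)%MS;
  ll_screen_direct : forall p, (S p :&: Rad i g p)%MS = 0;
  ll_str : subbundle i St;
  ll_str_nondegenerate : forall p, nondegenerate (g (i p)) (St p);
  ll_str_sum : forall p,
    (St p + Rad i g p == gorth (g (i p)) (TM i p))%MS;
  ll_str_direct : forall p, (St p :&: Rad i g p)%MS = 0
}.

Definition is_ltr (R : realType) (m n : nat) (M : manifold R m)
    (N : manifold R n) (i : M -> N) (g : N -> 'M[R]_n) (r : nat)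
    (S St ltr : M -> 'M[R]_n) : Prop :=
  forall p0, exists (W : set M) (E F : 'I_r -> M -> 'rV[R]_n),
    [/\ W p0, local_frame i W (Rad i g) E, local_frame i W ltr F &
     forall p, W p -> forall a b,
       [/\ (F a p <= gorth (g (i p)) (S p))%MS,
           (F a p <= gorth (g (i p)) (St p))%MS,
           bil (g (i p)) (E a p) (F b p) = (a == b)%:R &
           bil (g (i p)) (F a p) (F b p) = 0]].

Definition tr (R : realType) (n : nat) (T : Type) (St ltr : T -> 'M[R]_n)
    (p : T) : 'M[R]_n := (ltr p + St p)%MS.

(* The components nabla_X Y and h(X, Y) of the Gauss formula are the
   projections onto TM and tr(TM) in TN|_M = TM (+) tr(TM). *)
Definition induced_nabla (R : realType) (m n : nat) (M : manifold R m)
    (N : manifold R n) (i : M -> N)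
    (nabla : N -> 'rV[R]_n -> (N -> 'rV[R]_n) -> 'rV[R]_n)
    (St ltr : M -> 'M[R]_n) (X Y : M -> 'rV[R]_n) (p : M) : 'rV[R]_n :=
  cov i nabla X Y p *m proj_mx (TM i p) (tr St ltr p).

Definition second_form (R : realType) (m n : nat) (M : manifold R m)
    (N : manifold R n) (i : M -> N)
    (nabla : N -> 'rV[R]_n -> (N -> 'rV[R]_n) -> 'rV[R]_n)
    (St ltr : M -> 'M[R]_n) (X Y : M -> 'rV[R]_n) (p : M) : 'rV[R]_n :=
  cov i nabla X Y p *m proj_mx (tr St ltr p) (TM i p).

Definition screen_proj (R : realType) (m n : nat) (M : manifold R m)
    (N : manifold R n) (i : M -> N) (g : N -> 'M[R]_n) (S : M -> 'M[R]_n)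
    (Y : M -> 'rV[R]_n) (p : M) : 'rV[R]_n :=
  Y p *m proj_mx (S p) (Rad i g p).

(* h*_a(X, PY), the coefficient on E a of the Rad TM-component of nabla_X PY;
   multiplication by pinvmx (frame_mx E p) gives the coordinates in the basis
   (E a p)_a of its span. *)
Definition hstar (R : realType) (m n : nat) (M : manifold R m)
    (N : manifold R n) (i : M -> N) (g : N -> 'M[R]_n)
    (nabla : N -> 'rV[R]_n -> (N -> 'rV[R]_n) -> 'rV[R]_n)
    (S St ltr : M -> 'M[R]_n) (r : nat) (E : 'I_r -> M -> 'rV[R]_n) (a : 'I_r)
    (X Y : M -> 'rV[R]_n) (p : M) : R :=
  (induced_nabla i nabla St ltr X (screen_proj i g S Y) p
     *m proj_mx (Rad i g p) (S p) *m pinvmx (frame_mx E p)) 0 a.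

(* The tensors h and h*_a vanish identically: sections range over all open
   subsets of M (the frames E exist only locally). *)
Definition totally_geodesic (R : realType) (m n : nat) (M : manifold R m)
    (N : manifold R n) (i : M -> N)
    (nabla : N -> 'rV[R]_n -> (N -> 'rV[R]_n) -> 'rV[R]_n)
    (St ltr : M -> 'M[R]_n) : Prop :=
  forall (W : set M) X Y, open W ->
    section_of i W (TM i) X -> section_of i W (TM i) Y ->
    forall p, W p -> second_form i nabla St ltr X Y p = 0.

Definition screen_totally_geodesic (R : realType) (m n : nat)
    (M : manifold R m) (N : manifold R n) (i : M -> N) (g : N -> 'M[R]_n)
    (nabla : N -> 'rV[R]_n -> (N -> 'rV[R]_n) -> 'rV[R]_n)
    (r : nat) (S St ltr : M -> 'M[R]_n) : Prop :=
  forall (W : set M) (E : 'I_r -> M -> 'rV[R]_n) X Y,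
    local_frame i W (Rad i g) E ->
    section_of i W (TM i) X -> section_of i W (TM i) Y ->
    forall p, W p -> forall a, hstar i g nabla S St ltr E a X Y p = 0.

(* Ls and Ss are the bundles calligraphic L and S.  The sums in the second
   condition are plain sums of subspaces; the sum with D0 is orthogonal. *)
Record qgcr (R : realType) (m n : nat) (M : manifold R m) (N : manifold R n)
    (i : M -> N) (g phi : N -> 'M[R]_n)
    (S St ltr D1 D2 D0 Dbar Ls Ss : M -> 'M[R]_n) : Prop := Qgcr {
  qgcr_D1 : subbundle i D1;
  qgcr_D2 : subbundle i D2;
  qgcr_rad_sum : forall p, (D1 p + D2 p == Rad i g p)%MS;
  qgcr_rad_direct : forall p, (D1 p :&: D2 p)%MS = 0;
  qgcr_phi_D1 : forall p, (D1 p *m phi (i p) == D1 p)%MS;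
  qgcr_phi_D2 : forall p, (D2 p *m phi (i p) <= S p)%MS;
  qgcr_D0 : subbundle i D0;
  qgcr_Dbar : subbundle i Dbar;
  qgcr_screen_sum : forall p,
    (D2 p *m phi (i p) + Dbar p + D0 p == S p)%MS;
  qgcr_screen_orth : forall p,
    (D2 p *m phi (i p) + Dbar p <= gorth (g (i p)) (D0 p))%MS;
  qgcr_D0_nondegenerate : forall p, nondegenerate (g (i p)) (D0 p);
  qgcr_phi_D0 : forall p, (D0 p *m phi (i p) <= D0 p)%MS;
  qgcr_L : subbundle i Ls;
  qgcr_S : subbundle i Ss;
  qgcr_L_ltr : forall p, (Ls p <= ltr p)%MS;
  qgcr_S_str : forall p, (Ss p <= St p)%MS;
  qgcr_Dbar_sum : forall p,
    (Ss p *m phi (i p) + Ls p *m phi (i p) == Dbar p)%MS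
}.

Definition nonzero_bundle (R : realType) (n : nat) (T : Type)
    (D : T -> 'M[R]_n) : Prop := exists p, D p <> 0.

(* Main.v *)
(* For v in D0 with g(v, v) <> 0, extend v to a local section X of D0.  Since xi
   is transversal, eta = g(xi, .) vanishes on S(TM), so X = Y in the nearly
   Sasakian identity gives (nabla_X phi) X = g(X, X) xi.  On the other hand
   phi X lies in D0, hence in S(TM), and total geodesicity of M and of the screen
   keeps nabla_X (phi X) in S(TM), where eta vanishes; as eta o phi = 0, applying
   eta to the identity yields g(v, v) = 0.  Such a v exists because D0 is nonzero
   and non-degenerate. *)
Require Import Defs.
From mathcomp Require Import all_boot all_order all_algebra.
From mathcomp Require Import all_classical all_reals all_analysis.

Set Implicit Arguments.
Unset Strict Implicit.
Unset Printing Implicit Defensive.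

Import Order.TTheory GRing.Theory Num.Theory.
Import numFieldNormedType.Exports.

Local Open Scope classical_set_scope.
Local Open Scope ring_scope.

(** * Smooth maps between open sets of R^m *)

(** The obstacle is that X lives only along M, while the nearly Sasakian identity speaks of vector
    fields on open sets of N. Rather than extend X off M, the proof uses that (nabla_X phi) X
    depends only on X p: X is replaced by the field on N with the same value at i p and constant
    coefficients in a coordinate frame. Matching the two computations takes the Leibniz rule for
    [cov] and its agreement with [nabla] on fields restricted from N, hence chain rules and smooth
    coordinate frames, all on chart images, where the total functions [cmap] and [cinv] really are
    inverse to each other. The other obstacle is linear algebra: total geodesy is phrased through
    [proj_mx], whose components recombine to the given vector only when the two spaces are
    independent and span it. So TN = TM + tr(TM) has to be derived at each point, from S(TM^perp)
    and the dual frames of Rad TM and ltr(TM). Moreover tr(TM) is orthogonal to S(TM), which is why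
    a transversal xi makes eta = g(xi, .) vanish there. *)

Lemma near_eq_diff (R : realType) (V W : normedModType R) (f g : V -> W)
    (x : V) :
  (\near x, f x = g x) -> differentiable f x ->
  differentiable g x /\ 'd g x = 'd f x :> (V -> W).
Proof.
move=> fg df; have dfc : continuous ('d f x) by exact: diff_continuous.
(* The little-o expansion of f at x sees only values near x, so it is also an expansion of g;
   uniqueness of the differential does the rest. *)
have gE : g \o shift x = cst (g x) + 'd f x +o_ 0 id.
  apply/eqaddoP => _ /posnumP[e].
  have /diff_locally/eqaddoP/(_ e%:num ltac:(by [])) H := df.
  have fgx : f x = g x by exact: (nbhs_singleton fg).
  have fg0 : \forall y \near (0 : V), f (y + x) = g (y + x).
    by move: fg; rewrite (near_shift 0 x) /= subr0.
  near=> y.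
  have : `|(f \o shift x - (cst (f x) + 'd f x)) y| <= e%:num * `|id y|.
    by near: y.
  suff -> : (f \o shift x - (cst (f x) + 'd f x)) y =
            (g \o shift x - (cst (g x) + 'd f x)) y by [].
  by rewrite !fctE /= fgx; congr (_ - _); near: y.
have dg : 'd g x = 'd f x :> (V -> W) by exact: diff_unique.
by split=> //; apply/diff_locallyP; rewrite dg.
Unshelve. all: by end_near. Qed.

Section Smooth.
Variables (R : realType) (m : nat).
Implicit Types (U : set 'rV[R]_m).

(** Openness of U turns equality on U into equality near each of its points, so the directional
    derivatives agree on U too and the induction continues. *)
Lemma ndifferentiable_ext (V : normedModType R) k U (f g : 'rV[R]_m -> V) :
  open U -> (forall x, U x -> f x = g x) ->
  ndifferentiable k U f -> ndifferentiable k U g.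
Proof.
move=> oU; elim: k f g => [//|k IH] f g fg /= [df ddf].
have fgn x : U x -> \near x, f x = g x.
  by move=> Ux; apply: filterS (open_nbhs_nbhs (conj oU Ux)) => y /fg.
split=> [x Ux|v]; first by have [] := near_eq_diff (fgn x Ux) (df x Ux).
by apply: IH (ddf v) => x Ux; apply: near_eq_derive; exact: fgn.
Qed.

Lemma ndifferentiableW (V : normedModType R) k U (f : 'rV[R]_m -> V) :
  ndifferentiable k.+1 U f -> ndifferentiable k U f.
Proof.
elim: k f => [//|k IH] f [df ddf]; split=> // v; exact/IH/ddf.
Qed.

Lemma ndifferentiable_sub (V : normedModType R) k U U' (f : 'rV[R]_m -> V) :
  U' `<=` U -> ndifferentiable k U f -> ndifferentiable k U' f.
Proof.
move=> sU; elim: k f => [//|k IH] f [df ddf].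
by split=> [x /sU/df|v] //; apply/IH/ddf.
Qed.

Lemma ndifferentiable_cst (V : normedModType R) k U (a : V) :
  ndifferentiable k U (cst a : 'rV[R]_m -> V).
Proof.
elim: k a => [//|k IH] a; split=> [x _|v]; first exact: differentiable_cst.
rewrite (_ : (fun x => _) = cst 0); first exact: IH.
by apply/funext => x; exact: derive_cst.
Qed.

Lemma ndifferentiableD (V : normedModType R) k U (f g : 'rV[R]_m -> V) :
  open U -> ndifferentiable k U f -> ndifferentiable k U g ->
  ndifferentiable k U (f + g).
Proof.
move=> oU; elim: k f g => [//|k IH] f g /= [df ddf] [dg ddg].
split=> [x Ux|v]; first by apply: differentiableD; [exact: df|exact: dg].
apply: ndifferentiable_ext (IH _ _ (ddf v) (ddg v)) => // x Ux.
by rewrite deriveD//; apply: diff_derivable; [exact: df|exact: dg].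
Qed.

Lemma ndifferentiable_sum (V : normedModType R) k U n
    (f : 'I_n -> 'rV[R]_m -> V) :
  open U -> (forall i, ndifferentiable k U (f i)) ->
  ndifferentiable k U (\sum_i f i).
Proof.
move=> oU df; apply: big_ind => //; first exact: ndifferentiable_cst.
by move=> *; exact: ndifferentiableD.
Qed.

Lemma ndifferentiableM k U (f g : 'rV[R]_m -> R) :
  open U -> ndifferentiable k U f -> ndifferentiable k U g ->
  ndifferentiable k U (f * g).
Proof.
move=> oU; elim: k f g => [//|k IH] f g /= fk gk.
have [[df ddf] [dg ddg]] := (fk, gk).
split=> [x Ux|v]; first by apply: differentiableM; [exact: df|exact: dg].
(* In the Leibniz rule the derived factor has only k orders left, so the other factor is lowered
   from k.+1 to k. *)
have fv : ndifferentiable k U (f * (fun x => 'D_v g x)).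
  by apply: IH => //; exact: ndifferentiableW.
have gv : ndifferentiable k U (g * (fun x => 'D_v f x)).
  by apply: IH => //; exact: ndifferentiableW.
apply: ndifferentiable_ext (ndifferentiableD oU fv gv) => // x Ux.
by rewrite deriveM//; apply: diff_derivable; [exact: df|exact: dg].
Qed.

Lemma ndifferentiable_coord k U n (f : 'rV[R]_m -> 'rV[R]_n) (a : 'I_n) :
  open U -> ndifferentiable k U f -> ndifferentiable k U (fun x => f x 0 a).
Proof.
move=> oU; elim: k f => [//|k IH] f [df ddf]; split=> [x Ux|v].
  apply: (@differentiable_comp _ _ _ _ f (fun y : 'rV[R]_n => y 0 a)) => //.
    exact: df.
  exact: differentiable_coord.
apply: ndifferentiable_ext (IH _ (ddf v)) => // x Ux.
by rewrite derive_mx ?mxE//; apply: diff_derivable; exact: df.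
Qed.

Lemma ndifferentiable_scale k U n (f : 'rV[R]_m -> R) (w : 'rV[R]_n) :
  open U -> ndifferentiable k U f -> ndifferentiable k U (fun x => f x *: w).
Proof.
move=> oU; elim: k f => [//|k IH] f [df ddf].
have dfw x Ux := @differentiableZl R 'rV[R]_m 'rV[R]_n f w x (df x Ux).
have Dfw x Ux := @diffZl R 'rV[R]_m 'rV[R]_n f w x (df x Ux).
split=> [x Ux|v]; first exact: dfw.
apply: ndifferentiable_ext (IH _ (ddf v)) => // x Ux.
by rewrite [RHS]deriveE; [rewrite Dfw// deriveE//; exact: df|exact: dfw].
Qed.

Lemma fun_coordE n (f : 'rV[R]_m -> 'rV[R]_n) :
  f = \sum_a (fun x => f x 0 a *: (delta_mx 0 a : 'rV[R]_n)).
Proof. by apply/funext => x; rewrite fct_sumE; exact: row_sum_delta. Qed.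

Lemma ndifferentiable_rV k U n (f : 'rV[R]_m -> 'rV[R]_n) :
  open U -> (forall a, ndifferentiable k U (fun x => f x 0 a)) ->
  ndifferentiable k U f.
Proof.
move=> oU H; rewrite (fun_coordE f); apply: ndifferentiable_sum => // a.
exact: ndifferentiable_scale.
Qed.

End Smooth.

Lemma ndifferentiable_comp_fun (R : realType) (l m : nat) k
    (U : set 'rV[R]_l) (U' : set 'rV[R]_m) (f : 'rV[R]_l -> 'rV[R]_m)
    (h : 'rV[R]_m -> R) : open U -> open U' ->
  (forall x, U x -> U' (f x)) ->
  ndifferentiable k U f -> ndifferentiable k U' h ->
  ndifferentiable k U (h \o f).
Proof.
move=> oU oU' fU; elim: k h => [//|k IH] h fk [dh ddh].
have [df ddf] := fk; split=> [x Ux|v].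
  by apply: differentiable_comp; [exact: df|apply/dh/fU].
(* The chain rule in coordinates: D_v (h o f) is the sum over a of (D_v f)_a times (D_a h) o f, and
   each factor is k times differentiable. *)
pose F := \sum_a ((fun x => 'D_v f x 0 a) *
  ((fun y => 'D_(delta_mx 0 a) h y : R) \o f)).
have Fk : ndifferentiable k U F.
  apply: ndifferentiable_sum => // a; apply: ndifferentiableM => //.
    exact: (@ndifferentiable_coord _ _ k U m (fun x => 'D_v f x) a oU (ddf v)).
  by apply: IH; [exact: ndifferentiableW|exact: ddh].
apply: ndifferentiable_ext Fk => // x Ux; rewrite /F fct_sumE.
have dfx := df x Ux; have dhx := dh _ (fU x Ux).
rewrite deriveE; last exact: differentiable_comp.
rewrite diff_comp//= -(deriveE v dfx) [in RHS](row_sum_delta ('D_v f x)).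
rewrite linear_sum.
by apply: eq_bigr => a _; rewrite linearZ -deriveE.
Qed.

Lemma ndifferentiable_comp (R : realType) (l m n : nat) k
    (U : set 'rV[R]_l) (U' : set 'rV[R]_m) (f : 'rV[R]_l -> 'rV[R]_m)
    (h : 'rV[R]_m -> 'rV[R]_n) : open U -> open U' ->
  (forall x, U x -> U' (f x)) ->
  ndifferentiable k U f -> ndifferentiable k U' h ->
  ndifferentiable k U (h \o f).
Proof.
move=> oU oU' fU fk hk; apply: ndifferentiable_rV => // a.
apply: (@ndifferentiable_comp_fun _ _ _ k U U' f (fun y => h y 0 a)) => //.
exact: ndifferentiable_coord.
Qed.

Lemma near_eq_jacobian (R : realType) (m n : nat) (f h : 'rV[R]_m -> 'rV[R]_n)
    (x : 'rV[R]_m) :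
  (\near x, f x = h x) -> differentiable f x -> 'J h x = 'J f x.
Proof.
move=> fh df; have [dh dE] := near_eq_diff fh df.
by rewrite /jacobian -[X in _ = lin1_mx X]dE.
Qed.

Lemma jacobian_id (R : realType) (m : nat) (x : 'rV[R]_m) : 'J id x = 1%:M.
Proof.
apply/row_matrixP => a; rewrite !rowE mulmx1.
rewrite -deriveEjacobian; first exact: derive_id.
by apply: ex_diff.
Qed.

Lemma ndifferentiableZ (R : realType) (m n k : nat) (U : set 'rV[R]_m)
    (h : 'rV[R]_m -> R) (f : 'rV[R]_m -> 'rV[R]_n) :
  open U -> ndifferentiable k U h -> ndifferentiable k U f ->
  ndifferentiable k U (fun x => h x *: f x).
Proof.
move=> oU hk fk; apply: ndifferentiable_rV => // a.
rewrite (_ : (fun x => _) = h * (fun x => f x 0 a)); last first.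
  by apply/funext => x; rewrite mxE.
exact/ndifferentiableM/ndifferentiable_coord.
Qed.

Lemma smooth_on_differentiable (R : realType) (m : nat) (V : normedModType R)
    (U : set 'rV[R]_m) (f : 'rV[R]_m -> V) (x : 'rV[R]_m) :
  smooth_on U f -> U x -> differentiable f x.
Proof. by move=> /(_ 1%N)[df _]; exact: df. Qed.

(** * Charts *)

Section Charts.
Variables (R : realType) (T : topologicalType) (m : nat) (c : chart R T m).

(** Inside the open chart image, a point belongs to the image of A exactly when [cinv c] sends it
    into A, an open condition by continuity of [cinv c]. *)
Lemma chart_image_open (A : set T) :
  open A -> A `<=` cdom c -> open (cmap c @` A).
Proof.
move=> oA Ac; rewrite openE => _ [p Ap <-].
have cp : (cmap c @` cdom c) (cmap c p) by exists p => //; exact: Ac.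
have nA : nbhs (cmap c p) (cinv c @^-1` A).
  apply: (cinv_continuous cp); rewrite cmapK; last exact: Ac.
  exact: open_nbhs_nbhs.
have nc : nbhs (cmap c p) (cmap c @` cdom c).
  by apply: open_nbhs_nbhs; split=> //; exact: cimage_open.
apply: filterS (filterI nA nc) => x [/= Ax [q cq qx]].
by exists q => //; move: Ax; rewrite -qx cmapK.
Qed.

Lemma near_chart (A : set T) (p : T) : nbhs p A -> cdom c p ->
  \forall x \near cmap c p, A (cinv c x).
Proof.
move=> Ap cp; have cp' : (cmap c @` cdom c) (cmap c p) by exists p.
by apply: (cinv_continuous cp'); rewrite cmapK.
Qed.

End Charts.

(** * Chain rules for smooth maps between manifolds *)

Section SmoothMaps.
Variables (R : realType) (m n : nat) (M : manifold R m) (N : manifold R n).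
Variable f : M -> N.
Hypothesis f_smooth : smooth_map f.

Lemma smooth_map_open (W : set N) : open W -> open (f @^-1` W).
Proof. by move=> oW; have [/continuousP + _] := f_smooth; apply. Qed.

(** Inserting [cinv e \o cmap e] in the composite changes nothing near [cmap c p], because f maps a
    neighbourhood of p into [cdom e]; the chain rule then applies to the two factors. *)
Lemma derive_chart_comp (V : normedModType R) (c : chart R M m)
    (e : chart R N n) (F : N -> V) (p : M) :
  atlas c -> atlas e -> cdom c p -> cdom e (f p) ->
  differentiable (F \o cinv e) (cmap e (f p)) ->
  differentiable (F \o f \o cinv c) (cmap c p) /\
  forall v, 'D_v (F \o f \o cinv c) (cmap c p) =
    'D_(v *m 'J (cmap e \o f \o cinv c) (cmap c p)) (F \o cinv e)
      (cmap e (f p)).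
Proof.
move=> ac ae cp ep; set x := cmap c p; set h := cmap e \o f \o cinv c.
have hx : h x = cmap e (f p) by rewrite /h /x /= cmapK.
rewrite -hx => dF.
have dh : differentiable h x.
  apply: (smooth_on_differentiable (f_smooth.2 c e ac ae)).
  by exists p.
have E : \near x, ((F \o cinv e) \o h) x = (F \o f \o cinv c) x.
  apply: filterS (near_chart (A := f @^-1` cdom e) _ cp) => [y ey|].
    by rewrite /h /= cmapK.
  apply: open_nbhs_nbhs; split=> //; apply: smooth_map_open.
  exact: cdom_open.
have dFh := differentiable_comp dh dF.
have [d1 d2] := near_eq_diff E dFh.
split=> // v; rewrite (deriveE _ d1) d2 diff_comp//= (deriveE _ dF).
by rewrite -(deriveE _ dh) (deriveEjacobian _ dh).
Qed.

Lemma jacobian_chart_comp (k : nat) (c : chart R M m)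
    (e : chart R N n) (F : N -> 'rV[R]_k) (p : M) :
  atlas c -> atlas e -> cdom c p -> cdom e (f p) ->
  differentiable (F \o cinv e) (cmap e (f p)) ->
  'J (F \o f \o cinv c) (cmap c p) =
  'J (cmap e \o f \o cinv c) (cmap c p) *m
    'J (F \o cinv e) (cmap e (f p)).
Proof.
move=> ac ae cp ep dF; have [d1 d2] := derive_chart_comp ac ae cp ep dF.
apply/row_matrixP => a; rewrite !rowE mulmxA.
by rewrite -(deriveEjacobian _ d1) d2 (deriveEjacobian _ dF).
Qed.

Lemma smooth_along_comp (W : set N) (Z : N -> 'rV[R]_n) :
  open W -> smooth_field W Z -> smooth_along f (f @^-1` W) (Z \o f).
Proof.
move=> oW sZ c d ac ad k.
set U := cmap c @` _.
have oU : open U.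
  apply: chart_image_open; last by move=> p [[]].
  apply: openI; last by apply: smooth_map_open; exact: cdom_open.
  by apply: openI; [exact: smooth_map_open|exact: cdom_open].
pose U' := cmap d @` (W `&` cdom d `&` id @^-1` cdom d).
have oU' : open U'.
  apply: chart_image_open; last by move=> p [[]].
  by do 2?[apply: openI] => //; exact: cdom_open.
have fU : ndifferentiable k U (cmap d \o f \o cinv c).
  apply: ndifferentiable_sub (f_smooth.2 c d ac ad k).
  by move=> _ [p [[Wp cp] dp] <-]; exists p.
have sUU' x : U x -> U' ((cmap d \o f \o cinv c) x).
  by move=> [p [[Wp cp] dp] <-]; exists (f p) => //=; rewrite cmapK.
apply: ndifferentiable_ext
  (ndifferentiable_comp oU oU' sUU' fU (sZ d d ad ad k)).
  by [].
by move=> _ [p [[Wp cp] dp] <-] /=; rewrite !cmapK//.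
Qed.

End SmoothMaps.

Lemma smooth_map_id (R : realType) (m : nat) (M : manifold R m) :
  smooth_map (@id M).
Proof.
split; first by move=> x; exact: cvg_id.
exact: atlas_compatible.
Qed.

(** * Coordinate changes and coordinate frames *)

Section Manifold.
Variables (R : realType) (n : nat) (N : manifold R n).
Implicit Types c d e : chart R N n.

Lemma transition_differentiable c d (p : N) :
  atlas c -> atlas d -> cdom c p -> cdom d p ->
  differentiable (cmap d \o cinv c) (cmap c p).
Proof.
move=> ac ad cp dp.
by apply: (smooth_on_differentiable (atlas_compatible ac ad)); exists p.
Qed.

Lemma jacobian_cocycle c e d (p : N) :
  atlas c -> atlas e -> atlas d -> cdom c p -> cdom e p -> cdom d p ->
  'J (cmap e \o cinv c) (cmap c p) *m 'J (cmap d \o cinv e) (cmap e p) =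
  'J (cmap d \o cinv c) (cmap c p).
Proof.
move=> ac ae ad cp ep dp; apply/esym.
apply: (jacobian_chart_comp (smooth_map_id N) ac ae cp ep).
exact: transition_differentiable.
Qed.

Lemma jacobian_chart_id c (p : N) : atlas c -> cdom c p ->
  'J (cmap c \o cinv c) (cmap c p) = 1%:M.
Proof.
move=> ac cp; rewrite -(jacobian_id (cmap c p)); apply: near_eq_jacobian.
  have := open_nbhs_nbhs (conj (@cimage_open _ _ _ c) (imageP (cmap c) cp)).
  by apply: filterS => _ [q cq <-]; rewrite /= cmapK.
by apply: ex_diff.
Qed.

Lemma tcoord_chart_at (p : N) : tcoord (chart_at p) p = 1%:M.
Proof.
by apply: jacobian_chart_id; [exact: chart_at_atlas|exact: chart_at_dom].
Qed.

Lemma coord_field_tcoord c d (p : N) (a : 'I_n) :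
  atlas c -> atlas d -> cdom c p -> cdom d p ->
  coord_field c a p *m tcoord d p =
    delta_mx 0 a *m 'J (cmap d \o cinv c) (cmap c p).
Proof.
move=> ac ad cp dp; rewrite /coord_field /tcoord -mulmxA jacobian_cocycle//.
  exact: chart_at_atlas.
exact: chart_at_dom.
Qed.

Lemma coord_field_chart_at (p : N) (a : 'I_n) :
  coord_field (chart_at p) a p = delta_mx 0 a.
Proof.
rewrite /coord_field jacobian_chart_id ?mulmx1//; first exact: chart_at_atlas.
exact: chart_at_dom.
Qed.

Lemma field_coordE c (p : N) (v : 'rV[R]_n) : atlas c -> cdom c p ->
  v = \sum_a (v *m tcoord c p) 0 a *: coord_field c a p.
Proof.
move=> ac cp; under eq_bigr do rewrite /coord_field scalemxAl.
rewrite -mulmx_suml -row_sum_delta -mulmxA [X in v *m X]jacobian_cocycle//.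
- rewrite jacobian_chart_id ?mulmx1//; first exact: chart_at_atlas.
  exact: chart_at_dom.
- exact: chart_at_atlas.
- exact: chart_at_atlas.
- exact: chart_at_dom.
- exact: chart_at_dom.
Qed.

(** In a chart d the a-th coordinate field of c is the a-th partial derivative of the transition map
    from c to d, so k orders for the field cost k.+1 orders for the transition. *)
Lemma coord_field_smooth c (a : 'I_n) : atlas c ->
  smooth_field (cdom c) (coord_field c a).
Proof.
move=> ac c' d ac' ad k; set U := cmap c' @` _.
have oU : open U.
  apply: chart_image_open; last by move=> p [[]].
  by do 2?[apply: openI] => //; exact: cdom_open.
pose U' := cmap c @` (cdom c `&` cdom d).
have oU' : open U'.
  apply: chart_image_open; last by move=> p [].
  by apply: openI; exact: cdom_open.
have fU : ndifferentiable k U (cmap c \o cinv c').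
  apply: ndifferentiable_sub (atlas_compatible ac' ac k).
  by move=> _ [p [[Wp cp] dp] <-]; exists p.
have sUU' x : U x -> U' ((cmap c \o cinv c') x).
  by move=> [p [[Wp cp] dp] <-]; exists p => //=; rewrite cmapK.
have [_ /(_ (delta_mx 0 a)) DU'] := atlas_compatible ac ad k.+1.
apply: ndifferentiable_ext (ndifferentiable_comp oU oU' sUU' fU DU').
  by [].
move=> _ [p [[cp c'p] dp] <-] /=; rewrite cmapK// coord_field_tcoord//.
by rewrite deriveEjacobian//; exact: transition_differentiable.
Qed.

End Manifold.

(** * Connections *)

Section SmoothFun.
Variables (R : realType) (m : nat) (M : manifold R m).

Lemma smooth_fun_differentiable (W : set M) (h : M -> R) (p : M) :
  smooth_fun W h -> W p ->
  differentiable (h \o cinv (chart_at p)) (cmap (chart_at p) p).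
Proof.
move=> sh Wp; apply: (smooth_on_differentiable (sh _ (chart_at_atlas p))).
by exists p => //; split=> //; exact: chart_at_dom.
Qed.

Lemma smooth_fun_cst (W : set M) (a : R) : smooth_fun W (fun=> a).
Proof. by move=> c _ k; exact: ndifferentiable_cst. Qed.

Lemma near_eq_vderive (W : set M) (p : M) v (f h : M -> R) :
  open W -> W p -> (forall q, W q -> f q = h q) ->
  vderive p v f = vderive p v h.
Proof.
move=> oW Wp fh; apply: near_eq_derive.
have := near_chart (open_nbhs_nbhs (conj oW Wp)) (chart_at_dom p).
by apply: filterS => x /fh.
Qed.

Lemma vderive_cst (p : M) v (a : R) : vderive p v (fun=> a) = 0.
Proof. exact: derive_cst. Qed.

Lemma vderive_sumM (k : nat) (W : set M) (p : M) v (f h : 'I_k -> M -> R) :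
  W p -> (forall b, smooth_fun W (f b)) -> (forall b, smooth_fun W (h b)) ->
  vderive p v (fun q => \sum_b f b q * h b q) =
  \sum_b (vderive p v (f b) * h b p + f b p * vderive p v (h b)).
Proof.
move=> Wp sf sh; rewrite /vderive; set x := cmap _ p.
have xK : cinv (chart_at p) x = p by apply: cmapK; exact: chart_at_dom.
have df b : derivable (f b \o cinv (chart_at p)) x v.
  exact/diff_derivable/(smooth_fun_differentiable (sf b) Wp).
have dh b : derivable (h b \o cinv (chart_at p)) x v.
  exact/diff_derivable/(smooth_fun_differentiable (sh b) Wp).
rewrite (_ : _ \o _ = \sum_b ((f b \o cinv (chart_at p)) *
                              (h b \o cinv (chart_at p)))); last first.
  by apply/funext => y; rewrite fct_sumE.
rewrite derive_sum; last by move=> b; exact: derivableM.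
apply: eq_bigr => b _; rewrite deriveM// /= xK addrC.
by congr (_ + _); rewrite -[LHS]/(_ * _) mulrC.
Qed.

End SmoothFun.

(** * Vector fields along a smooth map *)

Section SmoothAlong.
Variables (R : realType) (m n : nat) (M : manifold R m) (N : manifold R n).
Variable f : M -> N.
Hypothesis f_smooth : smooth_map f.

Lemma smooth_along_sub (W W' : set M) (X : M -> 'rV[R]_n) :
  W' `<=` W -> smooth_along f W X -> smooth_along f W' X.
Proof.
move=> sW sX c d ac ad k; apply: ndifferentiable_sub (sX c d ac ad k).
by move=> _ [p [[/sW Wp cp] dp] <-]; exists p.
Qed.

Lemma smooth_along_domain_open (W : set M) (c : chart R M m)
    (d : chart R N n) : open W ->
  open (cmap c @` (W `&` cdom c `&` f @^-1` cdom d)).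
Proof.
move=> oW; apply: chart_image_open; last by move=> p [[]].
apply: openI; first by apply: openI => //; exact: cdom_open.
by apply: smooth_map_open => //; exact: cdom_open.
Qed.

Lemma smooth_along_ext (W : set M) (X Y : M -> 'rV[R]_n) : open W ->
  (forall p, W p -> X p = Y p) -> smooth_along f W X -> smooth_along f W Y.
Proof.
move=> oW XY sX c d ac ad k; apply: ndifferentiable_ext (sX c d ac ad k).
  exact: smooth_along_domain_open.
by move=> _ [p [[Wp cp] dp] <-]; rewrite cmapK// XY.
Qed.

Lemma smooth_along_sumZ (k : nat) (W : set M) (h : 'I_k -> M -> R)
    (Z : 'I_k -> M -> 'rV[R]_n) : open W ->
  (forall b, smooth_fun W (h b)) -> (forall b, smooth_along f W (Z b)) ->
  smooth_along f W (fun q => \sum_b h b q *: Z b q).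
Proof.
move=> oW sh sZ c d ac ad l; set U := cmap c @` _.
have oU : open U by exact: smooth_along_domain_open.
rewrite (_ : (fun x => _) = \sum_b (fun x => (h b \o cinv c) x *:
    (Z b (cinv c x) *m tcoord d (f (cinv c x))))); last first.
  apply/funext => x; rewrite fct_sumE mulmx_suml.
  by apply: eq_bigr => b _; rewrite -scalemxAl.
apply: ndifferentiable_sum => // b; apply: ndifferentiableZ => //.
  apply: ndifferentiable_sub (sh b c ac l).
  by move=> _ [p [[Wp cp] dp] <-]; exists p.
exact: sZ.
Qed.

Lemma smooth_along_coord (W : set M) (X : M -> 'rV[R]_n) (d : chart R N n)
    (a : 'I_n) : open W -> W `<=` f @^-1` cdom d -> atlas d ->
  smooth_along f W X -> smooth_fun W (fun q => (X q *m tcoord d (f q)) 0 a).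
Proof.
move=> oW Wd ad sX c ac k.
rewrite (_ : W `&` cdom c = W `&` cdom c `&` f @^-1` cdom d); last first.
  by rewrite setIAC (setIidl Wd).
rewrite /comp; apply: (@ndifferentiable_coord _ _ _ _ _
  (fun x => X (cinv c x) *m tcoord d (f (cinv c x)))) => //.
  exact: smooth_along_domain_open.
exact: sX.
Qed.

End SmoothAlong.

Section Connection.
Variables (R : realType) (n : nat) (N : manifold R n).
Variable nabla : N -> 'rV[R]_n -> (N -> 'rV[R]_n) -> 'rV[R]_n.
Hypothesis conn : affine_connection nabla.

Lemma nabla_sumZ (k : nat) (W : set N) (h : 'I_k -> N -> R)
    (Z : 'I_k -> N -> 'rV[R]_n) (p : N) v : open W -> W p ->
  (forall b, smooth_fun W (h b)) -> (forall b, smooth_field W (Z b)) ->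
  nabla p v (fun q => \sum_b h b q *: Z b q) =
  \sum_b (vderive p v (h b) *: Z b p + h b p *: nabla p v (Z b)).
Proof.
move=> oW Wp; have sid := smooth_map_id N.
elim: k h Z => [|k IH] h Z sh sZ.
  have := smooth_along_sumZ sid oW sh sZ.
  rewrite big_ord0 (_ : (fun q => _) = fun=> 0); last first.
    by apply/funext => q; rewrite big_ord0.
  (* The empty sum is the zero field, and additivity at 0 + 0 = 0 forces its covariant derivative to
     vanish. *)
  move=> s0; have := nabla_additive conn v oW Wp s0 s0; rewrite addr0.
  by move/(congr1 (fun w => w - nabla p v (fun=> 0))); rewrite subrr addrK.
pose r b := widen_ord (leqnSn k) b.
have s1 := smooth_along_sumZ (Z := fun b => Z (r b)) sid oW
  (fun b => sh (r b)) (fun b => sZ (r b)).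
pose Y := fun q => h ord_max q *: Z ord_max q.
have s2 : smooth_field W Y.
  have := smooth_along_sumZ (Z := fun=> Z ord_max) sid oW
    (fun _ : 'I_1 => sh ord_max)
    (fun _ => sZ ord_max).
  rewrite (_ : (fun q => _) = Y)//.
  by apply/funext => q; rewrite big_ord1.
rewrite big_ord_recr/= -(IH (h \o r) (Z \o r)); last 2 first.
- by move=> b; exact: sh.
- by move=> b; exact: sZ.
rewrite -(nabla_leibniz conn v oW Wp (sh ord_max) (sZ ord_max)).
rewrite -(nabla_additive conn v oW Wp s1 s2); congr (nabla p v _).
by apply/funext => q; rewrite big_ord_recr.
Qed.

End Connection.

(** * The connection induced along a smooth map *)

Section InducedConnection.
Variables (R : realType) (m n : nat) (M : manifold R m) (N : manifold R n).
Variable i : M -> N.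
Hypothesis i_smooth : smooth_map i.
Variable nabla : N -> 'rV[R]_n -> (N -> 'rV[R]_n) -> 'rV[R]_n.
Hypothesis conn : affine_connection nabla.

Lemma cov_local (W : set M) (X X' Y Z : M -> 'rV[R]_n) (p : M) :
  open W -> W p -> X p = X' p -> (forall q, W q -> Y q = Z q) ->
  cov i nabla X Y p = cov i nabla X' Z p.
Proof.
move=> oW Wp XE YZ; rewrite /cov XE; apply: eq_bigr => a _; rewrite YZ//.
congr (_ *: _ + _); apply: near_eq_vderive oW Wp _ => q Wq.
by rewrite YZ.
Qed.

(** The Leibniz rule for [cov]: the derivation terms come from the [vderive] part of its definition,
    while the [nabla] part is linear in the value of the field at p. *)
Lemma cov_sumZ (k : nat) (W : set M) (h : 'I_k -> M -> R)
    (Z : 'I_k -> M -> 'rV[R]_n) (X : M -> 'rV[R]_n) (p : M) :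
  open W -> W p ->
  (forall b, smooth_fun W (h b)) -> (forall b, smooth_along i W (Z b)) ->
  cov i nabla X (fun q => \sum_b h b q *: Z b q) p =
  \sum_b (vderive p (X p *m pinvmx (tangent_map i p)) (h b) *: Z b p +
          h b p *: cov i nabla X (Z b) p).
Proof.
move=> oW Wp sh sZ; rewrite /cov; set c := chart_at (i p); set u := _ *m _.
pose W' := W `&` i @^-1` cdom c.
have oW' : open W'.
  by apply: openI => //; apply: smooth_map_open => //; exact: cdom_open.
have W'p : W' p by split=> //; exact: chart_at_dom.
have sub : W' `<=` W by move=> q [].
have sh' b : smooth_fun W' (h b).
  move=> e ae l; apply: ndifferentiable_sub (sh b e ae l).
  by move=> _ [q [[Wq _] eq] <-]; exists q.
have sz a b : smooth_fun W' (fun q => (Z b q *m tcoord c (i q)) 0 a).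
  apply: smooth_along_coord => //; first by move=> q [].
    exact: chart_at_atlas.
  exact: smooth_along_sub (sZ b).
under eq_bigr => a _.
  rewrite (_ : (fun q => _) = fun q =>
    \sum_b h b q * (Z b q *m tcoord c (i q)) 0 a); last first.
    apply/funext => q; rewrite mulmx_suml summxE.
    by apply: eq_bigr => b _; rewrite -scalemxAl mxE.
  rewrite (vderive_sumM _ W'p sh' (sz a)) summxE !scaler_suml -big_split/=.
  over.
rewrite exchange_big/=; apply: eq_bigr => b _.
rewrite [X in _ = _ *: X + _]row_sum_delta !scaler_sumr -big_split/=.
apply: eq_bigr => a _.
rewrite tcoord_chart_at mulmx1 mxE scalerDr !scalerA addrA.
by rewrite -scalerDl.
Qed.

(** Expanding Z near i p in the coordinate frame and applying the Leibniz rule of [nabla] gives the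
    formula defining [cov], once the derivatives of the coefficients are matched through the chain
    rule for i. *)
Lemma cov_pullback (W : set N) (Z : N -> 'rV[R]_n) (X : M -> 'rV[R]_n) (p : M) :
  open W -> W (i p) -> smooth_field W Z -> (X p <= TM i p)%MS ->
  cov i nabla X (Z \o i) p = nabla (i p) (X p) Z.
Proof.
move=> oW Wp sZ Xp; rewrite /cov; set c := chart_at (i p).
have ac : atlas c by exact: chart_at_atlas.
have cp : cdom c (i p) by exact: chart_at_dom.
have sid := smooth_map_id N.
pose W' := W `&` cdom c.
have oW' : open W' by apply: openI => //; exact: cdom_open.
have W'p : W' (i p) by [].
have sZ' : smooth_field W' Z by apply: smooth_along_sub sZ => q [].
have sz a : smooth_fun W' (fun q => (Z q *m tcoord c q) 0 a).
  by apply: (smooth_along_coord sid) => // q [].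
have sc a : smooth_field W' (coord_field c a).
  by apply: smooth_along_sub (coord_field_smooth a ac) => q [].
rewrite (nabla_local conn (Z := fun q =>
    \sum_a (Z q *m tcoord c q) 0 a *: coord_field c a q) _ oW' W'p) //;
    last first.
  by move=> q [_ cq]; exact: field_coordE.
rewrite (nabla_sumZ conn _ oW' W'p sz sc); apply: eq_bigr => a _.
rewrite coord_field_chart_at tcoord_chart_at mulmx1.
suff -> : vderive p (X p *m pinvmx (tangent_map i p))
    (fun q => ((Z \o i) q *m tcoord c (i q)) 0 a) =
  vderive (i p) (X p) (fun q => (Z q *m tcoord c q) 0 a) by [].
have [_ H] := derive_chart_comp i_smooth (chart_at_atlas p) ac
  (chart_at_dom p) cp (smooth_fun_differentiable (sz a) W'p).
(* As X p lies in TM, pulling it back by [pinvmx] and pushing it forward by the tangent map returns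
   X p. *)
rewrite /vderive H -/(tangent_map i p) mulmxKpV//.
by move: Xp; rewrite genmxE.
Qed.

(* (nabla_X phi) Y is tensorial in Y, so it may be computed on N from the
   extension Z of Y p with constant coefficients in the coordinate frame. *)
Lemma cov_endo (phi : N -> 'M[R]_n) (W : set M) (X Y : M -> 'rV[R]_n) (p : M) :
  (forall (W : set N) X, open W -> smooth_field W X ->
    smooth_field W (fun p => X p *m phi p)) ->
  open W -> W p -> smooth_along i W Y -> (X p <= TM i p)%MS ->
  let Z := fun q => \sum_b Y p 0 b *: coord_field (chart_at (i p)) b q in
  cov i nabla X (fun q => Y q *m phi (i q)) p - cov i nabla X Y p *m phi (i p) =
  nabla (i p) (X p) (fun q => Z q *m phi q) - nabla (i p) (X p) Z *m phi (i p).
Proof.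
move=> sphi oW Wp sY Xp Z; pose c := chart_at (i p).
have ac : atlas c by exact: chart_at_atlas.
have cp : cdom c (i p) by exact: chart_at_dom.
have sid := smooth_map_id N.
pose W' := W `&` i @^-1` cdom c.
have oi : open (i @^-1` cdom c).
  by apply: smooth_map_open => //; exact: cdom_open.
have oW' : open W' by exact: openI.
have W'p : W' p by [].
have sY' : smooth_along i W' Y by apply: smooth_along_sub sY => q [].
have sy a : smooth_fun W' (fun q => (Y q *m tcoord c (i q)) 0 a).
  by apply: (smooth_along_coord i_smooth) => // q [].
have oc := @cdom_open _ _ _ c.
have sc a : smooth_field (cdom c) (coord_field c a).
  exact: coord_field_smooth.
have scphi a : smooth_field (cdom c) (fun q => coord_field c a q *m phi q).
  exact: sphi.
have sci a : smooth_along i W' (coord_field c a \o i).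
  apply: smooth_along_sub (smooth_along_comp i_smooth oc (sc a)).
  by move=> q [].
have scphii a : smooth_along i W' ((fun q => coord_field c a q *m phi q) \o i).
  apply: smooth_along_sub (smooth_along_comp i_smooth oc (scphi a)).
  by move=> q [].
rewrite (cov_local (X' := X) (Y := Y) (Z := fun q =>
   \sum_b (Y q *m tcoord c (i q)) 0 b *: (coord_field c b \o i) q) oW' W'p) //;
    last first.
  by move=> q [_ cq]; exact: field_coordE.
rewrite (cov_local (X' := X) (Z := fun q =>
   \sum_b (Y q *m tcoord c (i q)) 0 b *:
   ((fun q => coord_field c b q *m phi q) \o i) q) oW' W'p) //; last first.
  move=> q [_ cq]; rewrite [in LHS](field_coordE (Y q) ac cq) mulmx_suml.
  by apply: eq_bigr => b _; rewrite -scalemxAl.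
rewrite (cov_sumZ _ oW' W'p sy sci) (cov_sumZ _ oW' W'p sy scphii).
have -> : (fun q => Z q *m phi q) =
    fun q => \sum_b Y p 0 b *: (coord_field c b q *m phi q).
  apply/funext => q; rewrite mulmx_suml.
  by apply: eq_bigr => b _; rewrite -scalemxAl.
rewrite (nabla_sumZ conn _ oc cp (fun=> smooth_fun_cst _ _) sc).
rewrite (nabla_sumZ conn _ oc cp (fun=> smooth_fun_cst _ _) scphi).
rewrite !mulmx_suml -!sumrB; apply: eq_bigr => b _.
rewrite !vderive_cst !scale0r !add0r mulmxDl -!scalemxAl tcoord_chart_at mulmx1.
(* The derivatives of the coefficients of Y occur in both covariant derivatives with the same
   factor, phi applied to the frame vector; their cancellation is the tensoriality. *)
rewrite opprD addrACA subrr add0r.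
by rewrite !(cov_pullback oc cp _ Xp).
Qed.

End InducedConnection.

(** * Degenerate bilinear forms *)

Section Bilinear.
Variables (R : realType) (n : nat) (G : 'M[R]_n).
Implicit Types (u v w : 'rV[R]_n).

Lemma bilDl u v w : bil G (u + v) w = bil G u w + bil G v w.
Proof. by rewrite /bil !mulmxDl mxE. Qed.

Lemma bilZl a u w : bil G (a *: u) w = a * bil G u w.
Proof. by rewrite /bil -!scalemxAl mxE. Qed.

Lemma bilBl u v w : bil G (u - v) w = bil G u w - bil G v w.
Proof. by rewrite bilDl -scaleN1r bilZl mulN1r. Qed.

Lemma bil0l w : bil G 0 w = 0.
Proof. by rewrite -(scale0r 0) bilZl mul0r. Qed.

Lemma sub_gorthP m k (V : 'M[R]_(k, n)) (U : 'M[R]_(m, n)) :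
  reflect (forall v u, (v <= V)%MS -> (u <= U)%MS -> bil G v u = 0)
          (V <= gorth G U)%MS.
Proof.
apply: (iffP sub_kermxP) => [VU v u /submxP[a ->] /submxP[b ->]|H].
  by rewrite /bil trmx_mul -!mulmxA (mulmxA G) (mulmxA V) VU mul0mx mulmx0 mxE.
apply/matrixP => r s; rewrite mulmxA [RHS]mxE.
rewrite -[RHS](H (row r V) (row s U) (row_sub _ _) (row_sub _ _)).
by rewrite /bil tr_row colE mulmxA -colE -!row_mul [in RHS]mxE [in RHS]mxE.
Qed.

Lemma gorth_bil m (U : 'M[R]_(m, n)) v u :
  (v <= gorth G U)%MS -> (u <= U)%MS -> bil G v u = 0.
Proof. by move=> vU uU; move/sub_gorthP: vU; apply. Qed.

Hypothesis G_sym : G^T = G.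

Lemma bilC v w : bil G v w = bil G w v.
Proof.
by rewrite {1}/bil -[_ *m _ *m _]trmxK mxE !trmx_mul trmxK G_sym mulmxA.
Qed.

Lemma bilDr u v w : bil G w (u + v) = bil G w u + bil G w v.
Proof. by rewrite bilC bilDl !(bilC w). Qed.

Lemma bil_polarization (U : 'M[R]_n) :
  (forall v, (v <= U)%MS -> bil G v v = 0) ->
  forall v w, (v <= U)%MS -> (w <= U)%MS -> bil G v w = 0.
Proof.
move=> U0 v w vU wU; have := U0 (v + w) (addmx_sub vU wU).
rewrite bilDl !bilDr !U0// addr0 add0r (bilC w v) => /eqP.
by rewrite -mulr2n mulrn_eq0 => /eqP.
Qed.

(** Otherwise polarization makes U orthogonal to itself, so U is its own radical and must be
    zero. *)
Lemma nondegenerate_anisotropic (U : 'M[R]_n) :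
  Defs.nondegenerate G U -> U <> 0 ->
  exists2 v, (v <= U)%MS & bil G v v != 0.
Proof.
move=> ndU U0; apply: contrapT => H; apply: U0.
have H0 v : (v <= U)%MS -> bil G v v = 0.
  by move=> vU; apply: contrapT => /eqP vv; apply: H; exists v.
apply/eqP; rewrite -submx0 -ndU sub_capmx submx_refl/=.
by apply/sub_gorthP => v w; exact: bil_polarization.
Qed.

End Bilinear.


(** * The splitting into tangent and transversal spaces at a point *)

Section Transversal.
Variables (R : realType) (n r : nat) (G T S St L : 'M[R]_n).
Hypothesis G_sym : G^T = G.
Let Rd := (T :&: gorth G T)%MS.

(** By duality, the coefficients of v in the frame E are its products with the rows of F. *)
Lemma dual_frames_eq0 (E F : 'M[R]_(r, n)) v :
  (forall a b, bil G (row a E) (row b F) = (a == b)%:R) ->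
  (v <= E)%MS -> (forall w, (w <= F)%MS -> bil G v w = 0) -> v = 0.
Proof.
move=> EF /submxP[x ->] H; suff -> : x = 0 by rewrite mul0mx.
apply/rowP => b; rewrite [RHS]mxE -[RHS](H (row b F) (row_sub _ _)).
have -> : bil G (x *m E) (row b F) = \sum_a x 0 a * bil G (row a E) (row b F).
  rewrite mulmx_sum_row /bil !mulmx_suml summxE.
  by apply: eq_bigr => a _; rewrite -!scalemxAl mxE.
rewrite (bigD1 b)//= EF eqxx mulr1 big1 ?addr0// => a ab.
by rewrite EF (negbTE ab) mulr0.
Qed.

Variables (E F : 'M[R]_(r, n)).
Hypothesis St_nondegenerate : Defs.nondegenerate G St.
Hypothesis St_sum : (St + Rd == gorth G T)%MS.
Hypothesis St_direct : (St :&: Rd)%MS = 0.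
Hypotheses (E_span : (E == Rd)%MS) (F_span : (F == L)%MS).
Hypothesis F_St : forall b, (row b F <= gorth G St)%MS.
Hypothesis EF : forall a b, bil G (row a E) (row b F) = (a == b)%:R.

Let St_T : (St <= gorth G T)%MS.
Proof. by rewrite -(eqmxP St_sum) addsmxSl. Qed.

Let L_St : (L <= gorth G St)%MS.
Proof. by rewrite -(eqmxP F_span); apply/row_subP. Qed.

(** A common vector is orthogonal to Rad because it lies in T, and so is its St-part, as St is
    orthogonal to T. Hence its L-part is orthogonal to Rad and vanishes by duality; what remains
    lies in St and in T, thus in St and Rad, which meet in 0. *)
Lemma transversal_direct : (T :&: (L + St))%MS = 0.
Proof.
apply/eqP/rowV0P => w; rewrite sub_capmx => /andP[wT].
move=> /sub_addsmxP[[x y] /= wE].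
have xL : (x *m L <= L)%MS by rewrite submxMl.
have ySt : (y *m St <= St)%MS by rewrite submxMl.
have x0 : x *m L = 0.
  apply: (@dual_frames_eq0 F E) => [a b||e].
  - by rewrite bilC// EF eq_sym.
  - by rewrite (eqmxP F_span).
  rewrite (eqmxP E_span) sub_capmx => /andP[eT eTo].
  have -> : x *m L = w - y *m St by rewrite wE addrK.
  rewrite bilBl (gorth_bil (submx_trans ySt St_T) eT) subr0.
  by rewrite bilC//; exact: gorth_bil wT.
apply/eqP; rewrite -submx0 -St_direct !sub_capmx wT/=.
move: wE; rewrite x0 add0r => ->; rewrite ySt.
exact: submx_trans ySt St_T.
Qed.

(** A vector w orthogonal to the sum lies in the orthogonal of T, that is in St + Rad. Pairing with
    L kills its Rad-part by duality, since L is orthogonal to St; then w lies in St and is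
    orthogonal to St, hence is 0. *)
Lemma transversal_full : row_full (T + (L + St))%MS.
Proof.
set U := (T + _)%MS.
(* A trivial kernel gives the product G U^T full rank n, and its rank is at most that of U. *)
suff K0 : kermx (G *m U^T) = 0.
  have /eqP rn : row_free (G *m U^T) by rewrite -kermx_eq0 K0.
  by rewrite -col_leq_rank -mxrank_tr; have := mxrankM_maxr G U^T; rewrite rn.
apply/eqP/rowV0P => w wU.
have wU' u : (u <= U)%MS -> bil G w u = 0 by exact: gorth_bil.
have TU : (T <= U)%MS by exact: addsmxSl.
have LU : (L <= U)%MS by rewrite (submx_trans _ (addsmxSr _ _)) ?addsmxSl.
have StU : (St <= U)%MS by rewrite (submx_trans _ (addsmxSr _ _)) ?addsmxSr.
have : (w <= gorth G T)%MS.
  apply/sub_gorthP => v u /submxP[x ->] uT.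
  rewrite [x]mx11_scalar mul_scalar_mx bilZl wU' ?mulr0//.
  exact: submx_trans uT TU.
rewrite -(eqmxP St_sum) => /sub_addsmxP[[x y] /= wE].
have ySt : (x *m St <= St)%MS by rewrite submxMl.
have y0 : y *m Rd = 0.
  apply: (@dual_frames_eq0 E F) => // [|f].
    by rewrite (eqmxP E_span) submxMl.
  rewrite (eqmxP F_span) => fL.
  have -> : y *m Rd = w - x *m St by rewrite wE addrC addKr.
  rewrite bilBl wU' ?(submx_trans fL)// sub0r bilC//.
  by rewrite (gorth_bil (submx_trans fL L_St) ySt) oppr0.
apply/eqP; rewrite -submx0 -St_nondegenerate sub_capmx.
move: wE; rewrite y0 addr0 => wE; rewrite {1}wE ySt/=.
apply/sub_gorthP => v u /submxP[z ->] uSt.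
rewrite [z]mx11_scalar mul_scalar_mx bilZl wU' ?mulr0//.
exact: submx_trans uSt StU.
Qed.

End Transversal.

(** * Nearly Sasakian and lightlike geometry *)

(** Smoothness of phi is given for fields on N only, so Y is expanded in the coordinate frame of c;
    this is why W must map into one chart domain. *)
Lemma smooth_along_endo (R : realType) (m n : nat) (M : manifold R m)
    (N : manifold R n) (i : M -> N) (phi : N -> 'M[R]_n) (c : chart R N n)
    (W : set M) (Y : M -> 'rV[R]_n) :
  smooth_map i ->
  (forall (W : set N) X, open W -> smooth_field W X ->
    smooth_field W (fun p => X p *m phi p)) ->
  atlas c -> open W -> W `<=` i @^-1` cdom c -> smooth_along i W Y ->
  smooth_along i W (fun q => Y q *m phi (i q)).
Proof.
move=> si sphi ac oW Wc sY; have oc := @cdom_open _ _ _ c.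
have scphi a : smooth_along i W ((fun q => coord_field c a q *m phi q) \o i).
  apply: smooth_along_sub Wc _; apply: smooth_along_comp => //.
  by apply: sphi => //; exact: coord_field_smooth.
have sy a := smooth_along_coord si a oW Wc ac sY.
apply: (smooth_along_ext si oW _ (smooth_along_sumZ si oW sy scphi)) => q Wq.
rewrite [in RHS](field_coordE (Y q) ac (Wc q Wq)) mulmx_suml.
by apply: eq_bigr => b _; rewrite -scalemxAl.
Qed.

(** The coefficients of v in a local frame around p are kept constant. *)
Lemma subbundle_section (R : realType) (m n : nat) (M : manifold R m)
    (N : manifold R n) (i : M -> N) (D : M -> 'M[R]_n) (p : M) (v : 'rV[R]_n) :
  smooth_map i -> subbundle i D -> (v <= D p)%MS ->
  exists (W : set M) (X : M -> 'rV[R]_n),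
    [/\ open W, W p, section_of i W D X & X p = v].
Proof.
move=> si [k /(_ p)[W [E [Wp [oW sE ED]]]]] vD.
have /submxP[x xE] : (v <= frame_mx E p)%MS.
  by have [_ /eqmxP->] := ED p Wp.
have combE q : x *m frame_mx E q = \sum_a x 0 a *: E a q.
  by rewrite mulmx_sum_row; apply: eq_bigr => a _; rewrite rowK.
exists W, (fun q => \sum_a x 0 a *: E a q).
split=> //; last by rewrite -combE.
split; first by apply: smooth_along_sumZ => // a; exact: smooth_fun_cst.
by move=> q Wq; have [_ /eqmxP<-] := ED q Wq; rewrite -combE submxMl.
Qed.

Lemma local_frame_sub (R : realType) (m n : nat) (M : manifold R m)
    (N : manifold R n) (i : M -> N) (r : nat) (W W' : set M) (D : M -> 'M[R]_n)
    (E : 'I_r -> M -> 'rV[R]_n) :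
  open W' -> W' `<=` W -> local_frame i W D E -> local_frame i W' D E.
Proof.
move=> oW' sub [_ sE ED]; split=> // [a|q /sub]; last exact: ED.
exact: smooth_along_sub (sE a).
Qed.

Section NearlySasakian.
Variables (R : realType) (n : nat) (N : manifold R (2 * n).+1).
Variables (phi : N -> 'M[R]_((2 * n).+1)) (xi : N -> 'rV[R]_((2 * n).+1)).
Variables (eta : N -> 'cV[R]_((2 * n).+1)) (g : N -> 'M[R]_((2 * n).+1)).
Variable nabla : N -> 'rV[R]_((2 * n).+1) -> (N -> 'rV[R]_((2 * n).+1)) ->
  'rV[R]_((2 * n).+1).
Hypothesis hN : nearly_sasakian phi xi eta g nabla.

Let g_sym p : (g p)^T = g p.
Proof. exact: (Defs.metric_sym (ns_metric hN)). Qed.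

(** This is the compatibility of g with phi at second argument xi, where phi xi = 0 and eta(xi) =
    1. *)
Lemma eta_bil p v : eta_of eta p v = bil (g p) v (xi p).
Proof.
have := ns_compat hN p v (xi p).
rewrite (ns_phi_xi hN) (ns_eta_xi hN) mulr1 bilC// bil0l => /esym/eqP.
by rewrite subr_eq0 => /eqP.
Qed.

(** By tensoriality the left side can be computed on N from the constant-coefficient field Z through
    X p, to which the nearly Sasakian identity applies. That identity is pointwise, so eta(X) = 0 is
    asked at p only. *)
Lemma cov_phi_diagonal (m : nat) (M : manifold R m) (i : M -> N) (W : set M)
    (X : M -> 'rV[R]_((2 * n).+1)) (p : M) :
  smooth_map i -> open W -> W p -> section_of i W (TM i) X ->
  eta_of eta (i p) (X p) = 0 ->
  cov i nabla X (fun q => X q *m phi (i q)) p -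
    cov i nabla X X p *m phi (i p) =
  bil (g (i p)) (X p) (X p) *: xi (i p).
Proof.
move=> si oW Wp [sX XTM] etaX.
have conn := lc_connection (ns_levi_civita hN).
rewrite (cov_endo si conn (ns_phi_smooth hN) oW Wp sX (XTM p Wp)).
set c := chart_at (i p); set Z := fun q => \sum_b _.
have ac : atlas c by exact: chart_at_atlas.
have cp : cdom c (i p) by exact: chart_at_dom.
have oc := @cdom_open _ _ _ c.
have sZ : smooth_field (cdom c) Z.
  apply: (smooth_along_sumZ (smooth_map_id N) oc) => b.
    exact: smooth_fun_cst.
  exact: coord_field_smooth.
have ZE : Z (i p) = X p.
  rewrite [RHS]row_sum_delta; apply: eq_bigr => b _.
  by rewrite coord_field_chart_at.
have := ns_nearly hN oc cp sZ sZ; rewrite /nabla_endo ZE etaX !scale0r !subr0.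
(* With equal arguments both sides of the identity are doubled; the factor 2 is cancelled. *)
set u := _ - _; rewrite -mulr2n -scalerA -scaler_nat => /(scalerI _); apply.
by rewrite pnatr_eq0.
Qed.

End NearlySasakian.

(** * Totally geodesic lightlike submanifolds *)

Section Lightlike.
Variables (R : realType) (m n r : nat) (M : manifold R m) (N : manifold R n).
Variables (i : M -> N) (g : N -> 'M[R]_n) (S St ltr : M -> 'M[R]_n).
Hypothesis g_sym : forall p, (g p)^T = g p.
Hypothesis hll : lightlike_submanifold i g r S St.
Hypothesis hltr : is_ltr i g r S St ltr.

Lemma screen_sub_TM p : (S p <= TM i p)%MS.
Proof. by rewrite -(eqmxP (ll_screen_sum hll p)) addsmxSl. Qed.

(** The part ltr(TM) is orthogonal to S(TM) by its construction, and S(TM^perp) because it is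
    orthogonal to all of TM. *)
Lemma tr_orth_screen p : (tr St ltr p <= gorth (g (i p)) (S p))%MS.
Proof.
have [W [E [F [Wp _ [_ _ Fs] H]]]] := hltr p.
rewrite addsmx_sub; apply/andP; split.
  have [_ /eqmxP<-] := Fs p Wp; apply/row_subP => b; rewrite rowK.
  by have [] := H p Wp b b.
apply/sub_gorthP => v u vSt uS.
apply: (@gorth_bil _ _ _ _ (TM i p)); last exact: submx_trans (screen_sub_TM p).
apply: (submx_trans vSt).
by rewrite -(eqmxP (ll_str_sum hll p)) addsmxSl.
Qed.

(** This makes the two [proj_mx] components in the Gauss formula add up to the covariant
    derivative. *)
Lemma TM_tr p : (TM i p :&: tr St ltr p)%MS = 0 /\
  row_full (TM i p + tr St ltr p)%MS.
Proof.
have [W [E [F [Wp [_ _ Es] [_ _ Fs] H]]]] := hltr p.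
have [_ ED] := Es p Wp; have [_ FD] := Fs p Wp.
have FSt b : (row b (frame_mx F p) <= gorth (g (i p)) (St p))%MS.
  by rewrite rowK; have [] := H p Wp b b.
have EF a b : bil (g (i p)) (row a (frame_mx E p)) (row b (frame_mx F p)) =
    (a == b)%:R by rewrite !rowK; have [] := H p Wp a b.
split; first exact: (transversal_direct (g_sym (i p)) (ll_str_sum hll p)
  (ll_str_direct hll p) ED FD EF).
exact: (transversal_full (g_sym (i p)) (ll_str_nondegenerate hll p)
  (ll_str_sum hll p) ED FD FSt EF).
Qed.

Variable nabla : N -> 'rV[R]_n -> (N -> 'rV[R]_n) -> 'rV[R]_n.
Hypothesis tg : totally_geodesic i nabla St ltr.
Hypothesis stg : screen_totally_geodesic i g nabla r S St ltr.

(** Vanishing of h removes the transversal component, and vanishing of the h*_a the component in Rad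
    TM; only the screen component is left. *)
Lemma cov_screen (W : set M) X Y p : open W -> W p ->
  section_of i W (TM i) X -> section_of i W S Y ->
  (cov i nabla X Y p <= S p)%MS.
Proof.
move=> oW Wp sX [sY YS].
have si : smooth_map i by have [] := ll_submanifold hll.
have YTM q : W q -> (Y q <= TM i q)%MS.
  by move=> Wq; exact: submx_trans (YS q Wq) (screen_sub_TM q).
have [dir full] := TM_tr p.
have covE : induced_nabla i nabla St ltr X Y p = cov i nabla X Y p.
  rewrite -[RHS](@add_proj_mx _ _ _ (TM i p) (tr St ltr p))//;
    last exact: submx_full.
  have := tg oW sX (conj sY YTM) Wp.
  by rewrite /second_form => ->; rewrite addr0.
have [W1 [E [F [W1p Efr _ _]]]] := hltr p.
have [oW1 _ _] := Efr.
(* The hypothesis on the screen takes the sections and the frame of Rad TM over the same open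
   set. *)
pose W' := W `&` W1; have oW' : open W' by exact: openI.
have W'W : W' `<=` W by move=> q [].
have Efr' : local_frame i W' (Rad i g) E.
  by apply: local_frame_sub Efr => // q [].
have sX' : section_of i W' (TM i) X.
  by split=> [|q [Wq _]]; [exact: smooth_along_sub sX.1|exact: sX.2].
have sY' : section_of i W' (TM i) Y.
  by split=> [|q [Wq _]]; [exact: smooth_along_sub sY|exact: YTM].
have /= H := stg Efr' sX' sY' (conj Wp W1p).
have [_ _ /(_ p (conj Wp W1p))[_ ED]] := Efr'.
set w := induced_nabla i nabla St ltr X Y p in covE.
have wTM : (w <= TM i p)%MS by exact: proj_mx_sub.
have wRad : w *m proj_mx (Rad i g p) (S p) = 0.
  have wE : (w *m proj_mx (Rad i g p) (S p) <= frame_mx E p)%MS.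
    by rewrite (eqmxP ED) proj_mx_sub.
  (* A vector in the span of the frame is recovered from its coordinates, which are the h*_a. *)
  rewrite -(mulmxKpV wE) (_ : _ *m pinvmx _ = 0) ?mul0mx//.
  apply/rowP => a; rewrite [RHS]mxE -[RHS](H a) /hstar /w /induced_nabla.
  (* h*_a involves PY, which coincides with Y on W because Y is a section of the screen. *)
  rewrite (cov_local i nabla (X' := X) (Z := screen_proj i g S Y) oW Wp)// => q
    Wq.
  rewrite /screen_proj proj_mx_id//; first exact: ll_screen_direct hll q.
  exact: YS.
rewrite -covE -(@add_proj_mx _ _ _ (S p) (Rad i g p) w).
- by rewrite wRad addr0 proj_mx_sub.
- exact: ll_screen_direct hll p.
- by rewrite (eqmxP (ll_screen_sum hll p)).
Qed.

End Lightlike.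

Theorem corollary4p8 (R : realType) (n : nat) (N : manifold R (2 * n).+1)
    (phi : N -> 'M[R]_((2 * n).+1)) (xi : N -> 'rV[R]_((2 * n).+1))
    (eta : N -> 'cV[R]_((2 * n).+1)) (g : N -> 'M[R]_((2 * n).+1))
    (nabla : N -> 'rV[R]_((2 * n).+1) -> (N -> 'rV[R]_((2 * n).+1)) ->
             'rV[R]_((2 * n).+1))
    (hN : nearly_sasakian phi xi eta g nabla) :
  ~ exists (m : nat) (M : manifold R m) (i : M -> N) (r : nat)
      (S St ltr D1 D2 D0 Dbar Ls Ss : M -> 'M[R]_((2 * n).+1)),
      [/\ lightlike_submanifold i g r S St /\ is_ltr i g r S St ltr,
          qgcr i g phi S St ltr D1 D2 D0 Dbar Ls Ss,
          [/\ nonzero_bundle D0, nonzero_bundle D1,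
              nonzero_bundle D2 & nonzero_bundle Ss],
          totally_geodesic i nabla St ltr
            /\ screen_totally_geodesic i g nabla r S St ltr &
          forall p : M, (xi (i p) <= tr St ltr p)%MS].
Proof.
move=> [m [M [i [r [S [St [ltr [D1 [D2 [D0 [Dbar [Ls [Ss]]]]]]]]]]]]].
move=> [[hll hltr] hq [[p D0p] _ _ _] [tg stg] xitr].
have g_sym := Defs.metric_sym (ns_metric hN).
have si : smooth_map i by have [] := ll_submanifold hll.
have D0S q : (D0 q <= S q)%MS.
  by rewrite -(eqmxP (qgcr_screen_sum hq q)) addsmxSr.
have STM := screen_sub_TM hll.
have eta0 s : (s <= S p)%MS -> eta_of eta (i p) s = 0.
  move=> sS; rewrite (eta_bil hN) bilC//; apply: gorth_bil sS.
  exact: submx_trans (xitr p) (tr_orth_screen hll hltr p).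
have [v vD0 vv] :=
  nondegenerate_anisotropic (g_sym (i p)) (qgcr_D0_nondegenerate hq p) D0p.
have [W0 [X [oW0 W0p [sX XD0] Xp]]] := subbundle_section si (qgcr_D0 hq) vD0.
set c := chart_at (i p).
(* Shrinking to a chart domain makes phi X smooth along i. *)
pose W := W0 `&` i @^-1` cdom c.
have oW : open W.
  by apply: openI => //; apply: smooth_map_open => //; exact: cdom_open.
have Wp : W p by split=> //; exact: chart_at_dom.
have sXW : smooth_along i W X by apply: smooth_along_sub sX => q [].
have sXTM : section_of i W (TM i) X.
  split=> // q [Wq _].
  exact: submx_trans (XD0 q Wq) (submx_trans (D0S q) (STM q)).
have sXphi : section_of i W S (fun q => X q *m phi (i q)).
  split.
    apply: (smooth_along_endo si (ns_phi_smooth hN) (chart_at_atlas (i p)) oW)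
      => //.
    by move=> q [].
  move=> q [Wq _]; apply: submx_trans (D0S q).
  exact: submx_trans (submxMr _ (XD0 q Wq)) (qgcr_phi_D0 hq q).
have covS := cov_screen g_sym hll hltr tg stg oW Wp sXTM sXphi.
have etaX : eta_of eta (i p) (X p) = 0.
  by apply: eta0; rewrite Xp; exact: submx_trans vD0 (D0S p).
have := cov_phi_diagonal hN si oW Wp sXTM etaX.
move/(congr1 (eta_of eta (i p))).
(* Writing eta as g(., xi) serves to borrow the linearity of [bil]. *)
rewrite [RHS](eta_bil hN) bilZl -(eta_bil hN) (ns_eta_xi hN) mulr1.
rewrite (eta_bil hN) bilBl -!(eta_bil hN) (ns_eta_phi hN) (eta0 _ covS) subr0.
by rewrite Xp => /esym/eqP; rewrite (negbTE vv).
Qed.
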